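(* Let $p$ be an odd prime. For all $n, k \in \mathbb{Z}_+=\{0,1,2,\dots\}$ with $n > k$, $$\int_{\mathbb{Z}_p} B_{k,n}(x)\, d\mu_{-1}(x) = \begin{cases} 2+E_n & \text{if } k=0,\\[2mm] \displaystyle\binom{n}{k}\sum_{j=0}^{k}\binom{k}{j}(-1)^{k-j}E_{n-j} & \text{if } k>0.\end{cases}$$
   Context: For a uniformly differentiable function $f:\mathbb{Z}_p \to \mathbb{C}_p$ (in particular any polynomial), the fermionic $p$-adic invariant integral on $\mathbb{Z}_p$ is $$\int_{\mathbb{Z}_p} f(x)\, d\mu_{-1}(x) = \lim_{N\to\infty} \sum_{x=0}^{p^N-1} f(x)(-1)^x,$$ where the limit is taken in the $p$-adic topology. For $k,n\in\mathbb{Z}_+$ with $k\le n$ the Bernstein polynomial is $B_{k,n}(x) = \binom{n}{k} x^k (1-x)^{n-k}$. The Euler numbers $E_n\in\mathbb{Q}$ ($n\ge 0$) are defined by $\frac{2}{e^t+1} = \sum_{n=0}^{\infty} E_n \frac{t^n}{n!}$ and are regarded as elements of $\mathbb{Q}_p$. *)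

(* Defs.v *)
From HB Require Import structures.
From mathcomp Require Import all_boot all_order all_algebra.
From mathcomp Require Import all_classical all_reals all_analysis.

Set Implicit Arguments.
Unset Strict Implicit.
Unset Printing Implicit Defensive.

Import Order.TTheory GRing.Theory Num.Theory.
Import numFieldNormedType.Exports.

Local Open Scope classical_set_scope.
Local Open Scope ring_scope.

(* Z_p as the inverse limit of the rings Z/p^n: [x n] is the canonical
   representative (in [0, p^n)) of the residue of x modulo p^n. *)
Definition zp_compat (p : nat) : pred (nat -> int) :=
  fun x => `[< forall n, x n = (x n.+1 %% (p ^ n)%N)%Z >].

Record padic_int (p : nat) := MkZp {
  zp_res :> nat -> int;
  zp_compatP : zp_compat p zp_res }.

HB.instance Definition _ p := [isSub for @zp_res p].
HB.instance Definition _ p := [Choice of padic_int p by <:].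

Section ZpRing.
Variable p : nat.
Implicit Types x y z : padic_int p.

Lemma modz_expS (m : int) n :
  ((m %% (p ^ n.+1)%N)%Z %% (p ^ n)%N)%Z = (m %% (p ^ n)%N)%Z.
Proof.
rewrite {2}(divz_eq m (p ^ n.+1)%N) expnSr PoszM.
by rewrite [_%:Z * p%:Z]mulrC mulrA modzMDl.
Qed.

Lemma zp_resE x n : x n = (x n.+1 %% (p ^ n)%N)%Z.
Proof. by case: x => x Hx /=; move/asboolP: Hx; apply. Qed.

Lemma zp_resS x n : (x n.+1 = x n %[mod (p ^ n)%N])%Z.
Proof. by rewrite (zp_resE x n) modz_mod. Qed.

Lemma zp_res_mod x n : (x n %% (p ^ n)%N)%Z = x n.
Proof. by rewrite zp_resE modz_mod. Qed.

Lemma zp_ext x y : (forall n, x n = y n) -> x = y.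
Proof. by move=> e; apply: val_inj; apply/funext. Qed.

Lemma zp_mk_subproof (u : nat -> int) :
  (forall n, (u n.+1 = u n %[mod (p ^ n)%N])%Z) ->
  zp_compat p (fun n => (u n %% (p ^ n)%N)%Z).
Proof. by move=> Hu; apply/asboolP => n; rewrite modz_expS Hu. Qed.

Definition zp_mk u Hu : padic_int p := MkZp (@zp_mk_subproof u Hu).

Lemma zp_int_subproof (m : int) n : (m = m %[mod (p ^ n)%N])%Z.
Proof. by []. Qed.

Lemma zp_add_subproof x y n :
  (x n.+1 + y n.+1 = x n + y n %[mod (p ^ n)%N])%Z.
Proof. by rewrite -modzDm !zp_resS modzDm. Qed.

Lemma zp_opp_subproof x n : (- x n.+1 = - x n %[mod (p ^ n)%N])%Z.
Proof. by rewrite -modzNm zp_resS modzNm. Qed.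

Lemma zp_mul_subproof x y n :
  (x n.+1 * y n.+1 = x n * y n %[mod (p ^ n)%N])%Z.
Proof. by rewrite -modzMm !zp_resS modzMm. Qed.

Definition zp_int (m : int) : padic_int p := zp_mk (zp_int_subproof m).
Definition zp_add x y : padic_int p := zp_mk (zp_add_subproof x y).
Definition zp_opp x : padic_int p := zp_mk (zp_opp_subproof x).
Definition zp_mul x y : padic_int p := zp_mk (zp_mul_subproof x y).

Lemma zp_addA : associative zp_add.
Proof. by move=> x y z; apply: zp_ext => n /=; rewrite modzDmr modzDml addrA. Qed.

Lemma zp_addC : commutative zp_add.
Proof. by move=> x y; apply: zp_ext => n /=; rewrite addrC. Qed.

Lemma zp_add0 : left_id (zp_int 0) zp_add.
Proof. by move=> x; apply: zp_ext => n /=; rewrite modzDml add0r zp_res_mod. Qed.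

Lemma zp_addN : left_inverse (zp_int 0) zp_opp zp_add.
Proof. by move=> x; apply: zp_ext => n /=; rewrite modzDml addNr. Qed.

Lemma zp_mulA : associative zp_mul.
Proof. by move=> x y z; apply: zp_ext => n /=; rewrite modzMmr modzMml mulrA. Qed.

Lemma zp_mulC : commutative zp_mul.
Proof. by move=> x y; apply: zp_ext => n /=; rewrite mulrC. Qed.

Lemma zp_mul1 : left_id (zp_int 1) zp_mul.
Proof. by move=> x; apply: zp_ext => n /=; rewrite modzMml mul1r zp_res_mod. Qed.

Lemma zp_mulDl : left_distributive zp_mul zp_add.
Proof. by move=> x y z; apply: zp_ext => n /=; rewrite modzMml modzDm mulrDl. Qed.

HB.instance Definition _ :=
  GRing.isZmodule.Build (padic_int p) zp_addA zp_addC zp_add0 zp_addN.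
HB.instance Definition _ :=
  GRing.Zmodule_isComPzRing.Build (padic_int p) zp_mulA zp_mulC zp_mul1 zp_mulDl.

Lemma zp_natE (m : nat) : (m%:R : padic_int p) = zp_int m.
Proof.
elim: m => [//|m IH]; rewrite -natr1 IH; apply: zp_ext => n /=.
by rewrite modzDm -PoszD addn1.
Qed.

End ZpRing.

(* |0|_p = 0 and |z|_p = p^-m for z <> 0, where m is the p-adic valuation of z,
   i.e. the least m such that z is nonzero modulo p^(m+1). *)
Definition zp_abs (R : realType) (p : nat) (z : padic_int p) : R :=
  if pselect (exists m, z m.+1 != 0) is left nz
  then (p%:R) ^- (ex_minn nz) else 0.

(* [padic_absval emb v] says that the field K, together with the embedding
   emb of Z_p and the real-valued v, is a valued field extension of
   (Q_p, |.|_p).  Both Q_p and C_p are such fields; completeness and algebraic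
   closedness are not needed to speak of limits in K. *)
Record padic_absval (R : realType) (p : nat) (K : fieldType)
    (emb : {rmorphism padic_int p -> K}) (v : K -> R) : Prop := PadicAbsval {
  padic_ge0 : forall a, 0 <= v a;
  padic_eq0 : forall a, v a = 0 <-> a = 0;
  padicM : forall a b, v (a * b) = v a * v b;
  padicD : forall a b, v (a + b) <= Num.max (v a) (v b);
  padic_zp : forall z, v (emb z) = zp_abs R z }.

(* The integral of f : Z_p -> K against mu_{-1} exists and equals l; the limit
   is taken for the absolute value v of K. *)
Definition is_fermionic_integral (R : realType) (p : nat) (K : fieldType)
    (v : K -> R) (f : padic_int p -> K) (l : K) : Prop :=
  (fun N : nat => v (\sum_(0 <= x < p ^ N) f x%:R * (-1) ^+ x - l))
    @ \oo --> (0 : R).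

Definition bernstein (K : fieldType) (k n : nat) : {poly K} :=
  'C(n, k)%:R *: ('X^k * (1 - 'X) ^+ (n - k)).

(* Formal power series over Q, given by their coefficient sequences. *)
Definition fps := nat -> rat.
Definition fps_const (c : rat) : fps := fun n => if n is 0 then c else 0.
Definition fps_add (a b : fps) : fps := fun n => a n + b n.
Definition fps_mul (a b : fps) : fps :=
  fun n => \sum_(i < n.+1) a i * b (n - i)%N.
Definition fps_exp : fps := fun n => (n`!%:R)^-1.

(* [fps_inv_seq a n] lists the first n coefficients of 1/a, determined
   recursively by a * (1/a) = 1; see [fps_mulV]. *)
Fixpoint fps_inv_seq (a : fps) (n : nat) : seq rat :=
  if n is m.+1 then
    let s := fps_inv_seq a m in
    rcons s ((a 0)^-1 * (fps_const 1 m - \sum_(i < m) a i.+1 * s`_(m - i.+1)))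
  else [::].
Definition fps_inv (a : fps) : fps := fun n => (fps_inv_seq a n.+1)`_n.

Lemma size_fps_inv_seq a n : size (fps_inv_seq a n) = n.
Proof. by elim: n => //= n IH; rewrite size_rcons IH. Qed.

Lemma nth_fps_inv_seq a n i :
  (i < n)%N -> (fps_inv_seq a n)`_i = fps_inv a i.
Proof.
elim: n => // n IH; rewrite ltnS leq_eqVlt => /orP[/eqP->//|lt_in] /=.
by rewrite nth_rcons size_fps_inv_seq lt_in IH.
Qed.

Lemma fps_mulV (a : fps) : a 0 != 0 -> fps_mul a (fps_inv a) =1 fps_const 1.
Proof.
move=> a0 n; rewrite /fps_mul big_ord_recl subn0 {1}/fps_inv /=.
rewrite nth_rcons size_fps_inv_seq ltnn eqxx mulVKf //.
rewrite [X in _ - X + _](eq_bigr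
  (fun i : 'I_n => a (lift ord0 i) * fps_inv a (n - lift ord0 i)%N)) ?subrK //.
move=> i _; rewrite lift0 nth_fps_inv_seq //.
by rewrite ltn_subrL /=; apply: leq_ltn_trans (ltn_ord i).
Qed.

(* The Euler numbers: 2 / (e^t + 1) = \sum_n E_n t^n / n!. *)
Definition euler_gf : fps :=
  fps_mul (fps_const 2) (fps_inv (fps_add fps_exp (fps_const 1))).
Definition euler (n : nat) : rat := n`!%:R * euler_gf n.

Lemma euler_gfP :
  fps_mul (fps_add fps_exp (fps_const 1)) (fun n => euler n / n`!%:R)
    =1 fps_const 2.
Proof.
set a := fps_add _ _.
have gfE n : euler n / n`!%:R = 2 * fps_inv a n.
  rewrite /euler mulrC mulKf; last by rewrite pnatr_eq0 -lt0n fact_gt0.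
  by rewrite /euler_gf /fps_mul big_ord_recl subn0 big1 ?addr0 // => i _; rewrite mul0r.
move=> n; rewrite /fps_mul (eq_bigr (fun i : 'I_n.+1 => 2 * (a i * fps_inv a (n - i)%N)));
  last by move=> i _; rewrite gfE mulrCA.
rewrite -mulr_sumr; have := @fps_mulV a _ n; rewrite /fps_mul => ->.
  by case: n => [|n]; rewrite /= ?mulr1 ?mulr0.
by rewrite /a /fps_add /fps_exp /=.
Qed.

(* Main.v *)
(** Summing [(f (x + 1) + f x) (-1)^x] over [0 <= x < p^N] telescopes to
    [f 0 + f (p^N)].  For monomials this gives by strong induction the moments
    of mu_{-1}, which satisfy the recurrence of the Euler numbers; so the
    integral of a polynomial [f] is [L f], where [L] is the linear functional
    sending ['X^n] to [E_n], and [L (f (x + 1)) + L f = 2 f 0].  The latter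
    identity determines a linear functional, hence
    [L (f (1 - x)) = L (f (x + 2)) = 2 f 1 - 2 f 0 + L f].  Take
    [f = (1 - x)^k x^(n - k)], for which [f 0 = 0] since [k < n], and
    [f 1 = (k == 0)]. *)
From HB Require Import structures.
Require Import Defs.
From mathcomp Require Import all_boot all_order all_algebra.
From mathcomp Require Import all_classical all_reals all_analysis.
From mathcomp Require Import ring.

Import Order.TTheory GRing.Theory Num.Theory.
Import numFieldNormedType.Exports.

Local Open Scope ring_scope.

(** * Rational numbers inside a field of characteristic zero *)

Section RatrPchar0.
Variable K : fieldType.
Hypothesis charK : [pchar K] =i pred0.

Lemma intr_eq0_pchar0 (a : int) : (a%:~R == 0 :> K) = (a == 0).
Proof. by case: a => n; rewrite ?NegzE ?mulrNz ?oppr_eq0 -pmulrn (pcharf0P K).1. Qed.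

(** [ratr] is computed from the reduced numerator and denominator, so an unreduced fraction is
    compared with them by cross-multiplication. Sums and products of fractions come out unreduced,
    hence the two morphism lemmas below rest on this one. *)
Lemma ratr_frac (a b : int) : b != 0 ->
  ratr (a%:~R / b%:~R) = a%:~R / b%:~R :> K.
Proof.
move=> b0; rewrite /ratr; set x := (_ / _ : rat).
have dx0 := denq_neq0 x.
apply/eqP; rewrite eqr_div ?intr_eq0_pchar0 // -!intrM; apply/eqP; congr (_%:~R).
apply: (@intr_inj rat); rewrite !intrM; apply/eqP.
by rewrite -eqr_div ?intr_eq0 // divq_num_den.
Qed.

Lemma ratrD_pchar0 : {morph @ratr K : x y / x + y}.
Proof.
move=> x y; rewrite -{1}(divq_num_den x) -{1}(divq_num_den y).
rewrite addf_div ?intr_eq0 ?denq_neq0 // -!intrM -intrD.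
rewrite ratr_frac ?mulf_neq0 ?denq_neq0 // intrD !intrM.
by rewrite -addf_div ?intr_eq0_pchar0 ?denq_neq0.
Qed.

Lemma ratrM_pchar0 : {morph @ratr K : x y / x * y}.
Proof.
move=> x y; rewrite -{1}(divq_num_den x) -{1}(divq_num_den y).
rewrite mulf_div -!intrM ratr_frac ?mulf_neq0 ?denq_neq0 // !intrM.
by rewrite -mulf_div.
Qed.

End RatrPchar0.

(** * Recurrence of the Euler numbers *)

Lemma euler_rec (n : nat) :
  \sum_(i < n.+1) 'C(n, i)%:R * euler i + euler n = (2 * (n == 0)%N)%:R.
Proof.
have f0 m : m`!%:R != 0 :> rat by rewrite pnatr_eq0 -lt0n fact_gt0.
(* Compare the coefficients of [t^n] in [(e^t + 1) * sum_i E_i t^i / i! = 2], multiplied by [n!]. *)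
have := congr1 ( *%R n`!%:R) (euler_gfP n).
rewrite /fps_mul /fps_add /fps_exp.
under eq_bigr do rewrite mulrDl.
rewrite big_split mulrDr /=.
rewrite [\sum_(i < n.+1) fps_const 1 i * _]big_ord_recl.
rewrite [\sum_(i < n) _]big1 => [|i _]; last exact: mul0r.
rewrite addr0 subn0 mul1r mulrCA divff // mulr1.
have -> : n`!%:R * fps_const 2 n = (2 * (n == 0)%N)%:R.
  by case: n => [|n] /=; rewrite ?mulr0.
(* The convolution pairs [1 / i!] with [E_(n - i)]; reversing the index puts [E_i] beside
   [n! / (i! (n - i)!)]. *)
move=> <-; congr (_ + _); rewrite mulr_sumr (reindex_inj rev_ord_inj) /=.
apply: eq_bigr => i _; have le_in : (i <= n)%N by rewrite -ltnS.
rewrite subSS bin_sub // -(bin_fact le_in) !natrM.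
have h1 := f0 i; have h2 := f0 (n - i)%N.
by field; rewrite h1 h2.
Qed.

Lemma ratr_euler_rec (K : fieldType) (n : nat) : [pchar K] =i pred0 ->
  \sum_(i < n.+1) 'C(n, i)%:R * ratr (euler i) + ratr (euler n)
    = (2 * (n == 0)%N)%:R :> K.
Proof.
move=> charK; rewrite -ratr_nat -euler_rec ratrD_pchar0 //; congr (_ + _).
rewrite (big_morph _ (ratrD_pchar0 _ charK) (ratr_nat _ 0)).
by apply: eq_bigr => i _; rewrite ratrM_pchar0 // ratr_nat.
Qed.

(** * Linear functionals on polynomials, given by their moments *)

Lemma scalar_polyE (K : fieldType) (L : {scalar {poly K}}) (f : {poly K}) :
  L f = \sum_(i < size f) f`_i * L 'X^i.
Proof.
rewrite -{1}(coefK f) poly_def linear_sum; apply: eq_bigr => i _.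
by rewrite linearZ.
Qed.

Definition umbral (K : fieldType) (e : nat -> K) (f : {poly K}) : K :=
  \sum_(i < size f) f`_i * e i.

(** Padding with zero coefficients gives polynomials of different sizes a common range of summation,
    as linearity requires. *)
Lemma umbral_widen (K : fieldType) (e : nat -> K) (f : {poly K}) (m : nat) :
  (size f <= m)%N -> umbral _ e f = \sum_(i < m) f`_i * e i.
Proof.
move=> le_m; rewrite /umbral (big_ord_widen _ (fun i => f`_i * e i) le_m).
rewrite big_mkcond; apply: eq_bigr => i _; case: ltnP => // le_i.
by rewrite nth_default // mul0r.
Qed.

Lemma umbral_is_scalar (K : fieldType) (e : nat -> K) : scalar (umbral _ e).
Proof.
move=> a f g.
have le_f := leq_maxl (size f) (size g); have le_g := leq_maxr (size f) (size g).
rewrite (umbral_widen _ _ _ _ le_f) (umbral_widen _ _ _ _ le_g).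
rewrite (@umbral_widen _ _ _ (maxn (size f) (size g))); last first.
  apply: leq_trans (size_polyD _ _) _.
  by rewrite geq_max le_g (leq_trans (size_scale_leq _ _)).
rewrite mulr_sumr -big_split; apply: eq_bigr => i _ /=.
by rewrite coefD coefZ mulrDl mulrA.
Qed.

HB.instance Definition _ (K : fieldType) (e : nat -> K) :=
  GRing.isLinear.Build K {poly K} K *%R (umbral _ e) (umbral_is_scalar K e).

Lemma umbralXn (K : fieldType) (e : nat -> K) (n : nat) : umbral _ e 'X^n = e n.
Proof.
rewrite /umbral size_polyXn big_ord_recr big1 /= => [|i _].
  by rewrite coefXn eqxx mul1r add0r.
by rewrite coefXn (ltn_eqF (ltn_ord i)) mul0r.
Qed.

Lemma comp_polyD1_Xn (K : fieldType) (n : nat) :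
  'X^n \Po ('X + 1) = \sum_(i < n.+1) 'C(n, i)%:R *: 'X^i :> {poly K}.
Proof.
rewrite comp_Xn_poly exprD1n; apply: eq_bigr => i _.
by rewrite scaler_nat.
Qed.

(** By linearity it suffices to take [f = 'X^n]; expanding [('X + 1)^n] then turns the identity into
    the assumed recurrence, with [0^n = (n == 0)] on the right. *)
Lemma umbral_shift (K : fieldType) (e : nat -> K) :
  (forall n, \sum_(i < n.+1) 'C(n, i)%:R * e i + e n = (2 * (n == 0)%N)%:R) ->
  forall f, umbral _ e (f \Po ('X + 1)) + umbral _ e f = 2%:R * f.[0].
Proof.
move=> e_rec f; rewrite -[f]coefK poly_def raddf_sum !linear_sum horner_sum.
rewrite mulr_sumr -big_split; apply: eq_bigr => i _ /=.
rewrite linearZ /= !linearZ /= -mulrDr hornerZ hornerXn mulrCA; congr (_ * _).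
rewrite comp_polyD1_Xn linear_sum umbralXn expr0n -natrM -e_rec.
by congr (_ + _); apply: eq_bigr => j _; rewrite linearZ /= umbralXn.
Qed.

(** * Uniqueness from the shift identity, and reflection *)

Section ShiftFunctional.
Variable K : fieldType.
Hypothesis two_neq0 : 2%:R != 0 :> K.

(** [('X + 1)^n] is ['X^n] plus lower powers, which [D] kills by strong induction; what remains is
    [2 * D 'X^n = 0]. *)
Lemma scalar_shift_eq0 (D : {scalar {poly K}}) :
  (forall f, D (f \Po ('X + 1)) + D f = 0) -> forall f, D f = 0.
Proof.
move=> shiftD f; suff DX n : D 'X^n = 0.
  by rewrite scalar_polyE big1 // => i _; rewrite DX mulr0.
elim/ltn_ind: n => n IH.
have := shiftD 'X^n; rewrite comp_polyD1_Xn linear_sum big_ord_recr /=.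
rewrite big1 => [|i _]; last by rewrite linearZ /= IH // mulr0.
rewrite binn scale1r add0r => /eqP.
by rewrite -mulr2n -mulr_natl mulf_eq0 (negPf two_neq0) => /eqP.
Qed.

Variable L : {scalar {poly K}}.
Hypothesis shiftL : forall f, L (f \Po ('X + 1)) + L f = 2%:R * f.[0].

Lemma scalar_reflect (f : {poly K}) :
  L (f \Po (1 - 'X)) = L f + 2%:R * f.[1] - 2%:R * f.[0].
Proof.
(* [D g] compares [g (1 - X)] with [g (X + 2)] under [L]; it vanishes once [D] satisfies the
   homogeneous shift identity. *)
pose D g := L (g \Po (1 - 'X)) - L (g \Po ('X + 1) \Po ('X + 1)).
have D_scalar : scalar D.
  by move=> a g h; rewrite /D !(comp_polyD, comp_polyZ) !linearD !linearZ /=; ring.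
have shiftD g : D (g \Po ('X + 1)) + D g = 0.
  rewrite /D.
  (* Here [h = g (2 - X)], and [s] below is [g (X + 2)]. Both take the value [g 2] at 0, so the
     right-hand sides of their shift identities cancel. *)
  set h := g \Po ('X + 1) \Po (1 - 'X).
  have -> : g \Po (1 - 'X) = h \Po ('X + 1).
    rewrite /h -!comp_polyA; congr (_ \Po _).
    rewrite -polyC1 !(comp_polyD, comp_polyX, comp_polyC) raddfN /= comp_polyX; ring.
  set s := g \Po ('X + 1) \Po ('X + 1).
  have hh := shiftL h; have hs := shiftL s.
  rewrite !horner_comp !hornerE ?subr0 in hh hs.
  rewrite (canRL (addrK _) hh) (canRL (addrK _) hs); ring.
pose D_linear := GRing.isLinear.Build K {poly K} K *%R D D_scalar.
have D0 := scalar_shift_eq0 (HB.pack D D_linear) shiftD.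
have /eqP := D0 f; rewrite /= /D subr_eq0 => /eqP ->.
(* Two shifts bring [L (f (X + 2))] back to [L f], leaving the boundary values [f 1] and [f 0]. *)
have := shiftL (f \Po ('X + 1)); have := shiftL f.
rewrite horner_comp !hornerE => <- <-; ring.
Qed.

End ShiftFunctional.

(** The summand is [u x (-1)^x - u (x + 1) (-1)^(x + 1)]. *)
Lemma alternating_sum_telescope (K : comNzRingType) (u : nat -> K) (q : nat) :
  \sum_(0 <= x < q) (u x.+1 + u x) * (-1) ^+ x = u 0%N - u q * (-1) ^+ q.
Proof.
elim: q => [|q IH]; first by rewrite big_geq // expr0 mulr1 subrr.
by rewrite big_nat_recr //= IH exprS; ring.
Qed.

(** * Null sequences and moments for a p-adic absolute value *)

Section PadicAbsval.
Local Open Scope classical_set_scope.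
Context {R : realType} {p : nat} {K : fieldType}.
Context {emb : {rmorphism padic_int p -> K}} {v : K -> R}.
Hypotheses (hp : prime p) (hv : padic_absval emb v).

Lemma absval_natr_neq0 (m : nat) : (0 < m)%N -> m%:R != 0 :> K.
Proof.
move=> m0; apply/eqP => /(padic_eq0 hv).
rewrite -(rmorph_nat emb) (padic_zp hv) zp_natE /zp_abs.
case: pselect => [nz /eqP|[]]; last first.
  (* Since [m < p^(m + 1)], the residue of [m] modulo [p^(m + 1)] is [m] itself, hence nonzero. *)
  exists m; rewrite /= modz_nat modn_small ?eqz_nat -?lt0n //.
  by rewrite (leq_trans (ltnSn m)) // ltnW // ltn_expl // prime_gt1.
by rewrite invr_eq0 expf_eq0 pnatr_eq0 eqn0Ngt (prime_gt0 hp) andbF.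
Qed.

Lemma absval_pchar0 : [pchar K] =i pred0.
Proof.
apply/pcharf0P => -[|m]; first by rewrite !eqxx.
exact/negbTE/absval_natr_neq0.
Qed.

Lemma absval_p_lt1 : v p%:R < 1.
Proof.
rewrite -(rmorph_nat emb) (padic_zp hv) zp_natE /zp_abs.
case: pselect => // nz; case: ex_minnP => -[|m] /=.
  (* The valuation of [p] is not 0, as [p] vanishes modulo [p^1]. *)
  by rewrite expn1 modzz eqxx.
move=> _ _; rewrite invf_lt1 ?exprn_gt0 ?ltr0n ?prime_gt0 //.
by rewrite exprn_egt1 ?ltr1n ?prime_gt1.
Qed.

(** [K] carries no topology, so null sequences are expressed through their real absolute values. *)
Definition absval_null (u : nat -> K) := (fun N => v (u N)) @ \oo --> (0 : R).

Lemma absval_nullD (a b : nat -> K) :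
  absval_null a -> absval_null b -> absval_null (a \+ b).
Proof.
move=> ha hb.
apply: (@squeeze_cvgr _ _ _ _ (fun=> 0) (fun N => v (a N) + v (b N)));
  last 2 first.
- exact: cvg_cst.
- by rewrite -[0 in X in _ --> X](addr0 0); apply: cvgD.
near=> N; rewrite /= (padic_ge0 hv) /=.
apply: le_trans (padicD hv _ _) _.
by rewrite ge_max lerDl lerDr !(padic_ge0 hv).
Unshelve. all: by end_near. Qed.

Lemma absval_nullZ (c : K) (a : nat -> K) :
  absval_null a -> absval_null (fun N => c * a N).
Proof.
move=> ha; rewrite /absval_null.
have -> : (fun N => v (c * a N)) = (fun N => v c * v (a N)).
  by apply/funext => N; rewrite (padicM hv).
rewrite -(mulr0 (v c)); exact: cvgMr.
Qed.

Lemma absval_null_sum (m : nat) (c : nat -> K) (a : nat -> nat -> K) :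
  (forall i, (i < m)%N -> absval_null (a i)) ->
  absval_null (fun N => \sum_(i < m) c i * a i N).
Proof.
elim: m => [|m IH] ha.
  rewrite /absval_null; under eq_fun do rewrite /= big_ord0 ((padic_eq0 hv 0).2 erefl).
  exact: cvg_cst.
under eq_fun do rewrite big_ord_recr.
apply: absval_nullD; last exact/absval_nullZ/ha.
by apply: IH => i im; apply/ha/ltnW.
Qed.

Lemma absval_null_expn (n : nat) : (0 < n)%N ->
  absval_null (fun N => ((p ^ N)%:R : K) ^+ n).
Proof.
case: n => // n _; have v1 : v 1 = 1.
  have v1N0 : v 1 != 0 by apply/eqP => /(padic_eq0 hv)/eqP; rewrite oner_eq0.
  by apply: (mulfI v1N0); rewrite -(padicM hv) !mulr1.
have vX (x : K) m : v (x ^+ m) = v x ^+ m.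
  by elim: m => [//|m IH]; rewrite !exprS (padicM hv) IH.
have v_lt1 : `|v (p%:R ^+ n.+1)| < 1.
  rewrite ger0_norm ?(padic_ge0 hv) // vX exprn_ilt1 ?(padic_ge0 hv) //.
  exact: absval_p_lt1.
(* Exchanging the exponents in [(p^N)^n] exhibits a geometric sequence in [N]. *)
rewrite /absval_null; under eq_fun do rewrite /= natrX exprAC vX.
exact: cvg_expr.
Qed.

Hypothesis hodd : odd p.

Let altsum (f : {poly K}) (N : nat) : K :=
  \sum_(0 <= x < p ^ N) f.[x%:R] * (-1) ^+ x.

(** Telescoping with [u x = x^n]. As [p^N] is odd, the boundary term at [p^N] enters with sign [+].
    This is the Euler recurrence with one of its two terms [(n == 0)] replaced by [p^(N n)]. *)
Lemma altsum_Xn_rec (n N : nat) :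
  \sum_(i < n.+1) 'C(n, i)%:R * altsum 'X^i N + altsum 'X^n N
    = (n == 0)%:R + (p ^ N)%:R ^+ n.
Proof.
have := alternating_sum_telescope K (fun x => x%:R ^+ n) (p ^ N).
rewrite expr0n -signr_odd oddX hodd orbT expr1 mulrN1 opprK => <-.
under eq_bigr do rewrite mulr_sumr.
rewrite exchange_big -big_split; apply: eq_bigr => x _ /=.
rewrite hornerXn mulrDl; congr (_ + _); rewrite -natr1 exprD1n mulr_suml.
by apply: eq_bigr => i _; rewrite hornerXn mulrA mulr_natl.
Qed.

Lemma altsum_Xn_null (n : nat) :
  absval_null (fun N => altsum 'X^n N - ratr (euler n)).
Proof.
elim/ltn_ind: n => n IH.
have two_neq0 : 2%:R != 0 :> K by exact: absval_natr_neq0.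
(* [w] is the difference of the right-hand sides of the recurrences for [altsum] and for the Euler
   numbers; for [n = 0] it is identically 0. *)
pose w N := (p ^ N)%:R ^+ n - (n == 0)%:R : K.
have nullw : absval_null w.
  rewrite /w; case: n {IH w} => [|n].
    rewrite /absval_null; under eq_fun do rewrite /= subrr ((padic_eq0 hv 0).2 erefl).
    exact: cvg_cst.
  by under eq_fun do rewrite subr0; exact: absval_null_expn.
(* Subtract the two recurrences and solve for the error at [n]: it occurs twice, once as the top
   term of the binomial sum, whence the factor 1/2. *)
have -> : (fun N => altsum 'X^n N - ratr (euler n)) =
  (fun N => 2%:R^-1 * (w N + -1 * \sum_(i < n)
     'C(n, i)%:R * (altsum 'X^i N - ratr (euler i)))).
  apply/funext => N; apply: (mulfI two_neq0); rewrite mulVKf //.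
  have := altsum_Xn_rec n N; have := ratr_euler_rec K n absval_pchar0.
  rewrite !big_ord_recr /= !binn natrM => eB eA.
  under eq_bigr do rewrite mulrBr.
  rewrite sumrB /w.
  set A := \sum_(i < n) _ in eA *; set B := \sum_(i < n) _ in eB *.
  have -> : (p ^ N)%:R ^+ n = A + 1 * altsum 'X^n N + altsum 'X^n N - (n == 0)%:R.
    by rewrite eA addrAC subrr add0r.
  have -> : B = 2%:R * (n == 0)%:R - ratr (euler n) - ratr (euler n).
    by rewrite -eB; ring.
  ring.
apply/absval_nullZ/absval_nullD => //; apply/absval_nullZ.
apply: (absval_null_sum n (fun i => 'C(n, i)%:R)
  (fun i N => altsum 'X^i N - ratr (euler i))) => i.
exact: IH.
Qed.

(** Exchanging the sums over [x] and over the coefficients writes the error as a combination of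
    monomial errors, with a number of terms independent of [N]. *)
Lemma fermionic_integral_poly (f : {poly K}) :
  is_fermionic_integral v (fun x : padic_int p => f.[emb x])
    (umbral _ (fun n => ratr (euler n)) f).
Proof.
rewrite /is_fermionic_integral.
rewrite -/(absval_null (fun N => \sum_(0 <= x < p ^ N) f.[emb x%:R] * (-1) ^+ x
  - umbral _ (fun n => ratr (euler n)) f)).
suff -> : (fun N => \sum_(0 <= x < p ^ N) f.[emb x%:R] * (-1) ^+ x -
      umbral _ (fun n => ratr (euler n)) f) =
    (fun N => \sum_(i < size f) f`_i * (altsum 'X^i N - ratr (euler i))).
  apply: (absval_null_sum (size f) (fun i => f`_i)
    (fun i N => altsum 'X^i N - ratr (euler i))) => i _.
  exact: altsum_Xn_null.
apply/funext => N.
under [RHS]eq_bigr do rewrite mulrBr mulr_sumr.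
rewrite sumrB exchange_big; congr (_ - _); apply: eq_bigr => x _ /=.
rewrite rmorph_nat horner_coef mulr_suml.
by apply: eq_bigr => i _; rewrite hornerXn mulrA.
Qed.

End PadicAbsval.

Theorem theorem3 (R : realType) (p : nat) (hp : prime p) (hodd : odd p)
    (K : fieldType) (emb : {rmorphism padic_int p -> K}) (v : K -> R)
    (hv : padic_absval emb v) (n k : nat) (hkn : (k < n)%N) :
  is_fermionic_integral v (fun x : padic_int p => (bernstein K k n).[emb x])
    (if k == 0%N then 2 + ratr (euler n)
     else 'C(n, k)%:R *
          \sum_(0 <= j < k.+1)
             'C(k, j)%:R * (-1) ^+ (k - j) * ratr (euler (n - j))).
Proof.
have := fermionic_integral_poly hp hv hodd (bernstein K k n).
set e := fun i => ratr (euler i); set L := umbral _ e.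
have charK := absval_pchar0 hp hv.
have two_neq0 : 2%:R != 0 :> K by exact: (absval_natr_neq0 hp hv).
have shiftL : forall f, L (f \Po ('X + 1)) + L f = 2%:R * f.[0].
  by apply: umbral_shift => m; exact: ratr_euler_rec.
pose f : {poly K} := (1 - 'X) ^+ k * 'X^(n - k).
have -> : bernstein K k n = 'C(n, k)%:R *: (f \Po (1 - 'X)).
  rewrite /bernstein /f comp_polyM comp_Xn_poly rmorphXn /=.
  congr (_ *: (_ ^+ k * _)).
  rewrite -polyC1 comp_polyD comp_polyC raddfN /= comp_polyX; ring.
(* Expanding [(-X + 1)^k] in powers [(-X)^(k - j)] and multiplying by [X^(n - k)] produces exactly
   the exponents [n - j] of the claimed formula. *)
have fE : f = \sum_(j < k.+1) ('C(k, j)%:R * (-1) ^+ (k - j)) *: 'X^(n - j).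
  rewrite /f addrC exprDn mulr_suml; apply: eq_bigr => j _.
  have le_jk : (j <= k)%N by rewrite -ltnS.
  have -> : (n - j = k - j + (n - k))%N by rewrite addnBAC // subnKC // ltnW.
  rewrite expr1n mulr1 [(- 'X) ^+ _]exprNn exprD -mul_polyC polyCM
    polyC_natr polyC_exp polyCN polyC1.
  by rewrite -mulr_natl !mulrA.
have Lf : L f = \sum_(0 <= j < k.+1)
    'C(k, j)%:R * (-1) ^+ (k - j) * ratr (euler (n - j)).
  rewrite fE /L linear_sum big_mkord; apply: eq_bigr => j _.
  by rewrite linearZ /= umbralXn.
have f0 : f.[0] = 0 by rewrite /f hornerM hornerXn expr0n subn_eq0 leqNgt hkn mulr0.
have f1 : f.[1] = (k == 0%N)%:R.
  by rewrite /f hornerM hornerXn expr1n mulr1 horner_exp !hornerE subrr expr0n.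
have LfC : L (f \Po (1 - 'X)) = L f + 2%:R * f.[1] - 2%:R * f.[0].
  exact: (scalar_reflect _ two_neq0 _ shiftL f).
have -> : L ('C(n, k)%:R *: (f \Po (1 - 'X))) = 'C(n, k)%:R * L (f \Po (1 - 'X)).
  exact: linearZ.
rewrite LfC Lf f0 f1 mulr0 subr0.
(* The boundary term [2 * f.[1]] is 2 for [k = 0], where the sum reduces to [E_n], and 0
   otherwise. *)
case: eqP => [->|_]; last by rewrite mulr0 addr0.
by rewrite big_nat1 !bin0 subnn expr0 subn0 !mul1r mulr1 [_ + 2]addrC.
Qed.
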